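(* Work in $\mathsf{ZFC}$. Let $\kappa$ be a cardinal and let $\nu,\theta$ be cardinals such that ${\rm cf}(\kappa)=\nu\leq\theta<\kappa$. Let $\langle\kappa_\alpha:\alpha<\nu\rangle$ be a continuous increasing sequence of cardinals with $\sup_{\alpha<\nu}\kappa_\alpha=\kappa$. Suppose that for every $\alpha<\nu$, $\mathscr{F}_{\alpha+1}$ is a $\kappa_{\alpha+1}$-complete $\theta^+$-Rowbottom filter over $\kappa_{\alpha+1}$, and that $\gamma^\theta<\kappa$ for every $\gamma<\kappa$. Then there exists a $\theta^+$-Rowbottom filter over $\kappa$.
   Context: For a cardinal $\lambda$ and a cardinal $\mu$, a filter $\mathscr{F}$ over $\lambda$ is called $\mu$-Rowbottom if it is uniform, contains all end-segments $\lambda\setminus\beta$ ($\beta<\lambda$), and for every $\gamma<\lambda$ and every function $f:[\lambda]^{<\omega}\rightarrow\gamma$ there is $x\in\mathscr{F}$ with $|f''[x]^{<\omega}|<\mu$. Here $[x]^{<\omega}$ is the set of finite subsets of $x$. *)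

(* Defs.v *)
From mathcomp Require Import all_boot all_order finmap.
From mathcomp Require Import boolp classical_sets functions cardinality filter.

Set Implicit Arguments.
Unset Strict Implicit.
Unset Printing Implicit Defensive.

Import Order.TTheory.

Local Open Scope classical_set_scope.
Local Open Scope card_scope.
Local Open Scope order_scope.

Definition card_lt (T U : Type) (A : set T) (B : set U) : Prop :=
  A #<= B /\ ~ (A #= B).

Section Ordinals.

(* Ordinals are the elements of a well-ordered type O, i.e. of an arbitrarily
   long initial segment of the ordinals; the ordinal a is identified, as in von
   Neumann's definition, with the set of its predecessors. No notion below
   depends on how far O extends beyond the ordinals it is applied to. *)
Context {d : Order.disp_t} {O : orderType d}.

Definition well_ordered : Prop := well_founded (fun x y : O => x < y).

Definition below (a : O) : set O := [set x | x < a].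

Definition is_cardinal (a : O) : Prop :=
  forall b : O, b < a -> ~ (below b #= below a).

Definition is_succ_cardinal (a b : O) : Prop :=
  [/\ is_cardinal b, a < b &
      forall c : O, is_cardinal c -> a < c -> b <= c].

Definition is_succ (a b : O) : Prop :=
  a < b /\ forall c : O, a < c -> b <= c.

Definition is_limit (a : O) : Prop :=
  (exists b : O, b < a) /\ (forall b : O, ~ is_succ b a).

Definition cofinal_map (a k : O) (g : below a -> below k) : Prop :=
  forall y : below k, exists x : below a, val y <= val (g x).

Definition is_cofinality (k nu : O) : Prop :=
  (exists g : below nu -> below k, cofinal_map g) /\
  (forall a : O, (exists g : below a -> below k, cofinal_map g) -> nu <= a).

Definition increasing_below (nu : O) (k : O -> O) : Prop :=
  forall a b : O, a < b -> b < nu -> k a < k b.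

Definition continuous_below (nu : O) (k : O -> O) : Prop :=
  forall a : O, a < nu -> is_limit a -> supremums (k @` below a) (k a).

Definition filter_complete (mu : O) (T : Type) (F : set_system T) : Prop :=
  forall G : set (set T),
    G `<=` F -> card_lt G (below mu) -> F (\bigcap_(A in G) A).

Definition filter_uniform (lam : O) (F : set_system (below lam)) : Prop :=
  forall A : set (below lam), F A -> A #= below lam.

Definition fin_subsets (lam : O) (x : set (below lam)) :
    set {fset (below lam)} :=
  [set s | [set` s] `<=` x].

Definition Rowbottom (mu lam : O) (F : set_system (below lam)) : Prop :=
  [/\ ProperFilter F,
      filter_uniform F,
      forall b : O, b < lam -> F [set x : below lam | b <= val x] &
      forall (gam : O) (f : {fset (below lam)} -> below gam), gam < lam ->
        exists2 x : set (below lam),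
          F x & card_lt (f @` fin_subsets x) (below mu)].

End Ordinals.

(* Main.v *)
Require Import Defs.
From mathcomp Require Import all_boot all_order finmap.
From mathcomp Require Import boolp classical_sets functions cardinality filter.

Import Order.TTheory.
Local Open Scope classical_set_scope.
Local Open Scope card_scope.
Local Open Scope order_scope.

(** The filter on [kappa] consists of the sets whose trace on [kap (a + 1)]
    belongs to [F (a + 1)] for all large [a < nu].  Given [f] with values in
    [gam < kappa], keep only the blocks [kap a, kap (a + 1)) with
    [kap a > gam ^ theta].  For each finite list of blocks [l] define a map [X l]
    sending a finite set to a set of at most [theta] values of [f]: [X nil] is
    [t |-> {f t}], and [X (a :: l) t], for [t] included in [kap a], is the union
    of the [X l (t U u)] over the finite subsets [u] of some [A a l] in
    [F (a + 1)].  As [X l] takes at most [gam ^ theta] values, the Rowbottom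
    property and completeness (intersecting over all [t] below [kap a]) yield
    [A a l] such that this union is again of size at most [theta].  Intersecting
    over the [nu]-many lists gives sets [A a]; peeling off the topmost block of a
    finite subset of their union repeatedly shows that every value of [f] there
    lies in the union of the sets [X l fset0]. *)

(** * Comparison of cardinalities across arbitrary types *)

(** Choice turns [R] into an injection. Working with a relation spares the construction of maps
    between subtypes. *)
Lemma card_le_rel {T U : Type} {A : set T} {B : set U} (R : T -> U -> Prop) :
  (forall x, A x -> exists2 y, B y & R x y) ->
  (forall x x' y, A x -> A x' -> R x y -> R x' y -> x = x') -> A #<= B.
Proof.
move=> RAB Rinj.
have /choice[f fP] : forall x : A, exists y : B, R (val x) (val y).
  move=> x; have [y By Rxy] := RAB _ (set_valP x).
  by exists (exist _ y (mem_set By)).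
apply/card_leP/injfunPex; exists f => // x y _ _ fxy.
apply/val_inj/(Rinj _ _ (val (f x))); [exact: set_valP|exact: set_valP|exact: fP|].
by rewrite fxy; exact: fP.
Qed.

(** The injection between subtypes is extended to all of [T], with [u] as the default value outside
    [A]. *)
Lemma card_le_fun {T U : Type} {A : set T} {B : set U} (u : U) :
  A #<= B -> exists2 f : T -> U,
    forall x, A x -> B (f x) &
    forall x y, A x -> A y -> f x = f y -> x = y.
Proof.
move=> /card_leP/injfunPex[g _ ginj].
have /choice[f fP] : forall x, exists y : U,
    forall Ax : x \in A, y = val (g (exist _ x Ax)).
  move=> x; have [Ax|nAx] := pselect (x \in A).
    exists (val (g (exist _ x Ax))) => Ax'; congr (val (g _)).
    exact: val_inj.
  by exists u => Ax; have := nAx Ax.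
exists f => [x Ax|x y Ax Ay].
  by rewrite (fP x (mem_set Ax)); exact: set_valP.
rewrite (fP x (mem_set Ax)) (fP y (mem_set Ay)) => /val_inj gxy.
have := ginj (exist _ x (mem_set Ax)) (exist _ y (mem_set Ay)).
by rewrite !inE => /(_ Logic.I Logic.I gxy) [].
Qed.

Lemma card_le_setX {T T' U U' : Type} (A : set T) (A' : set T') (B : set U)
    (B' : set U') : A #<= B -> A' #<= B' -> A `*` A' #<= B `*` B'.
Proof.
move=> AB AB'.
have [[b Bb]|B0] := pselect (B !=set0); last first.
  have B00 : B = set0 by apply/eqP/negPn/negP => /set0P.
  move: AB; rewrite B00 => /card_le0P ->; rewrite set0X; exact: card_ge0.
have [[b' Bb']|B0] := pselect (B' !=set0); last first.
  have B00 : B' = set0 by apply/eqP/negPn/negP => /set0P.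
  move: AB'; rewrite B00 => /card_le0P ->; rewrite setX0; exact: card_ge0.
have [f fAB finj] := card_le_fun b AB.
have [g gAB ginj] := card_le_fun b' AB'.
apply: (card_le_rel (fun p q => q = (f p.1, g p.2))).
  by move=> [x y] [/= Ax Ay]; exists (f x, g y) => //; split; [exact: fAB|exact: gAB].
move=> [x y] [x' y'] q [/= Ax Ay] [/= Ax' Ay'] -> [fx gy].
by rewrite (finj _ _ Ax Ax' fx) (ginj _ _ Ay Ay' gy).
Qed.

(* Choosing recursively, for each [p], an element of [B] not used below [p]
   either fails at some [p] or embeds [T] into [B]. *)
Lemma wf_card_le_or {T U : Type} (R : T -> T -> Prop) (B : set U) :
  well_founded R -> (forall p q, [\/ p = q, R p q | R q p]) ->
  (exists p, B #<= [set q | R q p]) \/ [set: T] #<= B.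
Proof.
move=> wfR Rtot; apply/or_asboolP; rewrite -implyNb; apply/implyP => /asboolPn noB.
apply/asboolP.
(* If [h] exhausted [B], sending each element of [B] to some [q] where it is used would embed [B]
   into the predecessors of [p]. *)
have new p (h : forall q, R q p -> U) :
    exists2 u, B u & forall q (Rqp : R q p), h q Rqp <> u.
  apply: contrapT => nu; apply: noB; exists p.
  apply: (card_le_rel (fun u q => exists Rqp : R q p, h q Rqp = u)).
    move=> u Bu; apply: contrapT => nq; apply: nu; exists u => // q Rqp hu.
    by apply: nq; exists q => //; exists Rqp.
  move=> u u' q _ _ [Rqp <-] [Rqp' <-].
  by rewrite (Prop_irrelevance Rqp Rqp').
pose F p h := projT1 (cid2 (new p h)).
pose r := Fix wfR (fun=> U) F.
have rE p : r p = F p (fun q _ => r q).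
  apply: (Fix_eq wfR (fun=> U) F) => x f g fg; congr (F x _).
  by apply: functional_extensionality_dep => y; apply: functional_extensionality_dep.
have rB p : B (r p) by rewrite rE /F; case: cid2.
have rN p q : R q p -> r q <> r p.
  by rewrite (rE p) /F; case: cid2 => u Bu /= uP Rqp; exact: (uP q Rqp).
apply: (card_le_rel (fun p u => u = r p)); first by move=> p _; exists (r p).
move=> p q _ _ _ -> rpq; case: (Rtot p q) => // Rpq.
  by have := rN _ _ Rpq.
by have := rN _ _ Rpq; rewrite rpq.
Qed.

(** The dichotomy above, applied to the subtype [D] with [R] read on values; it replaces any appeal
    to order types. *)
Lemma wf_card_le_or_set {T U : Type} (R : T -> T -> Prop) (D : set T)
    (B : set U) :
  well_founded R -> (forall p q, [\/ p = q, R p q | R q p]) ->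
  (exists2 p, D p & B #<= [set q | D q /\ R q p]) \/ D #<= B.
Proof.
move=> wfR Rtot.
have [| |[p Bp]|DB] := @wf_card_le_or D U (fun p q => R (val p) (val q)) B.
- suff H x : forall p : D, val p = x -> Acc (fun p q : D => R (val p) (val q)) p.
    by move=> p; exact: H (erefl _).
  elim/(well_founded_ind wfR): x => x IH p px; constructor => q.
  by rewrite px => /IH; apply.
- move=> p q; case: (Rtot (val p) (val q)) => [/val_inj|Rpq|Rqp];
  [exact: Or31|exact: Or32|exact: Or33].
- left; exists (val p); first exact: set_valP.
  apply: (card_le_trans Bp); apply: (card_le_rel (fun q q' => q' = val q)).
    by move=> q Rqp; exists (val q) => //; split => //; exact: set_valP.
  by move=> q q' y _ _ -> /val_inj.
- by right; rewrite -(card_le_eql (card_setT D)).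
Qed.

(** Hilbert's hotel along an injection [e] of the natural numbers into [A]: [x] goes to [e 0], any
    other [e n] to [e n.+1], and the remaining points stay fixed. *)
Lemma infinite_card_le_setU1 {T : Type} (A : set T) (x : T) :
  infinite_set A -> x |` A #<= A.
Proof.
move=> /infiniteP/(card_le_fun x)[e eA einj].
have {}einj m n : e m = e n -> m = n by apply: einj.
pose R z w := [\/ z = x /\ w = e 0%N,
                  z <> x /\ (exists2 n, z = e n & w = e n.+1) |
                  [/\ z <> x, w = z & forall n, z <> e n]].
apply: (card_le_rel R).
  move=> z; have [->|zx] := pselect (z = x).
    by exists (e 0%N); [exact: eA|apply: Or31].
  move=> [//|Az]; have [[n zn]|nz] := pselect (exists n, z = e n).
    by exists (e n.+1); [exact: eA|apply: Or32; split => //; exists n].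
  exists z => //; apply: Or33; split => // n zn; apply: nz; by exists n.
move=> z z' w _ _ [[-> ->]|[zx [n -> ->]]|[zx -> zn]].
- case=> [[-> _//]|[_ [m -> /einj//]]|[_ <- h]]; by have := h 0%N.
- by case=> [[_ /einj//]|[_ [m -> /einj[->]]]|[_ <- h]] //; have := h n.+1.
- by case=> [[_ /zn//]|[_ [m _ /zn//]]|[]].
Qed.

(** * Cardinal arithmetic of initial segments of [O] *)

Section OrdinalCardinality.
Context {d : Order.disp_t} {O : orderType d}.
Hypothesis O_wo : @well_ordered d O.
Implicit Types a b c : O.

Lemma below_subset {a b} : a <= b -> below a `<=` below b.
Proof. by move=> ab x /lt_le_trans; apply. Qed.

Lemma card_le_below {a b} : a <= b -> below a #<= below b.
Proof. by move=> ab; apply/subset_card_le/below_subset. Qed.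

Lemma cardinal_card_lt {a b} : is_cardinal b -> a < b -> ~ (below b #<= below a).
Proof.
move=> bcard ab ba; apply: (bcard a ab); apply/card_eqPle; split => //.
exact/card_le_below/ltW.
Qed.

Lemma card_lt_below {T : Type} {A : set T} {a b} :
  is_cardinal b -> a < b -> A #<= below a -> card_lt A (below b).
Proof.
move=> bcard ab Aa; split.
  exact: (card_le_trans Aa (card_le_below (ltW ab))).
by move=> /card_eqPle[_ bA]; apply: (cardinal_card_lt bcard ab (card_le_trans bA Aa)).
Qed.

Lemma order_trichotomy (x y : O) : [\/ x = y, x < y | y < x].
Proof. by case: (ltgtP x y) => ?; [apply: Or32|apply: Or33|apply: Or31]. Qed.

(** If [A] embeds into no proper initial segment of [below b], the dichotomy embeds [below b] into
    [A], and Cantor-Bernstein contradicts strictness. *)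
Lemma card_ltE {T : Type} {A : set T} {b} :
  card_lt A (below b) -> exists2 a, a < b & A #<= below a.
Proof.
move=> [Ab nAb].
have [[p pb Ap]|bA] :=
    wf_card_le_or_set _ (below b) A O_wo order_trichotomy; last first.
  by exfalso; apply: nAb; apply/card_eqPle.
exists p => //; apply: (card_le_trans Ap); apply: subset_card_le => q [_ qp].
exact: qp.
Qed.

Lemma wf_least (P : O -> Prop) : (exists a, P a) ->
  exists2 a, P a & forall b, P b -> a <= b.
Proof.
move=> [a]; elim/(well_founded_ind O_wo): a => a IH Pa.
have [[b [ba Pb]]|nb] := pselect (exists b, b < a /\ P b); first exact: IH Pb.
exists a => // b Pb; rewrite leNgt; apply/negP => ba; apply: nb; by exists b.
Qed.

Lemma exists_cardinal a :
  exists b, [/\ is_cardinal b, b <= a & below a #<= below b].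
Proof.
have [|b /card_eqPle[ab ba] bmin] := wf_least (fun b => below a #= below b).
  by exists a; exact: card_eqxx.
exists b; split => //; last by apply: bmin; exact: card_eqxx.
move=> c cb /card_eqPle[cb' bc]; have : b <= c.
  apply: bmin; apply/card_eqPle; split; first exact: card_le_trans ab bc.
  exact: card_le_trans cb' ba.
by rewrite leNgt cb.
Qed.

Lemma succ_cardinal_le {a b x} :
  is_succ_cardinal a b -> x < b -> below x #<= below a.
Proof.
move=> [_ _ bmin] xb; have [c [ccard cx xc]] := exists_cardinal x.
apply: (card_le_trans xc); apply: card_le_below.
rewrite leNgt; apply/negP => /(bmin _ ccard) bc.
by have := lt_le_trans xb (le_trans bc cx); rewrite ltxx.
Qed.

(** If [x] were the largest element, [below a] would be [below x] plus one point, hence no larger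
    than the infinite set [below x]. *)
Lemma cardinal_no_max {a x} : is_cardinal a -> infinite_set (below a) ->
  x < a -> exists2 y, x < y & y < a.
Proof.
move=> acard ainf xa; apply: contrapT => nmax.
have ale : below a `<=` x |` below x.
  move=> y ya; rewrite /below /=; case: (ltgtP y x) => xy; [by right| |by left].
  by exfalso; apply: nmax; exists y.
have xinf : infinite_set (below x).
  move=> xfin; apply: ainf; apply: sub_finite_set ale _.
  by rewrite finite_setU; split => //; exact: finite_set1.
apply: (cardinal_card_lt acard xa).
exact: (card_le_trans (subset_card_le ale) (infinite_card_le_setU1 _ x xinf)).
Qed.

(* Goedel's ordering of pairs: the predecessors of a pair all lie in the square
   of an ordinal just above its maximum. *)
Definition max_lexi (p q : O * O) : Prop :=
  [\/ Order.max p.1 p.2 < Order.max q.1 q.2,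
      Order.max p.1 p.2 = Order.max q.1 q.2 /\ p.1 < q.1 |
      [/\ Order.max p.1 p.2 = Order.max q.1 q.2, p.1 = q.1 & p.2 < q.2]].

(** Three nested inductions: on the maximum, on the first coordinate, on the second. *)
Lemma max_lexi_wf : well_founded max_lexi.
Proof.
suff H m x y : Order.max x y = m -> Acc max_lexi (x, y).
  by move=> [x y]; exact: H (erefl _).
elim/(well_founded_ind O_wo): m x y => m IHm x.
elim/(well_founded_ind O_wo): x => x IHx y.
elim/(well_founded_ind O_wo): y => y IHy xym.
constructor => -[x' y'] [/=|[/=]|[/=]].
- by rewrite xym => /IHm; apply.
- by rewrite xym => xym' /IHx; apply.
- by rewrite xym => + xx'; rewrite xx' => xym' /IHy; apply.
Qed.

Lemma max_lexi_total p q : [\/ p = q, max_lexi p q | max_lexi q p].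
Proof.
case: p q => [x y] [x' y'].
case: (ltgtP (Order.max x y) (Order.max x' y')) => m.
- by apply: Or32; apply: Or31.
- by apply: Or33; apply: Or31.
case: (ltgtP x x') => [xx|xx|xx].
- by apply: Or32; apply: Or32.
- by apply: Or33; apply: Or32.
case: (ltgtP y y') => [yy|yy|yy].
- by apply: Or32; apply: Or33.
- by apply: Or33; apply: Or33.
- by apply: Or31; rewrite xx yy.
Qed.

(** Hessenberg's theorem. If [a] is not a cardinal, pass to an equinumerous [b < a]. If it is one,
    failure embeds [below a] into an initial segment of Goedel's ordering, hence into the square of
    some [below m] with [m < a], which is finite or handled by induction. *)
Lemma below_setX_le {a} :
  infinite_set (below a) -> below a `*` below a #<= below a.
Proof.
elim/(well_founded_ind O_wo): a => a IH ainf.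
have [acard|] := pselect (is_cardinal a); last first.
  move=> /existsNP[b /not_implyP[ba /contrapT/card_eqPle[bla alb]]].
  have binf : infinite_set (below b).
    by move=> bfin; apply: ainf; exact: card_le_finite alb bfin.
  apply: card_le_trans (card_le_setX _ _ _ _ alb alb) _.
  exact: card_le_trans (IH b ba binf) bla.
have [[[x y] [/= xa ya] le]|//] :=
  wf_card_le_or_set _ (below a `*` below a) (below a) max_lexi_wf max_lexi_total.
(* Predecessors of [(x, y)] may have the same maximum, so [m] must lie strictly above it. *)
have [|m lt_m ma] := @cardinal_no_max a (Order.max x y) acard ainf.
  by rewrite gt_max xa ya.
have {}le : below a #<= below m `*` below m.
  apply: (card_le_trans le); apply: subset_card_le => -[x' y'] [_ lexi].
  have : Order.max x' y' < m.
    apply: le_lt_trans lt_m; case: lexi => /=; first exact: ltW.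
      by move=> [-> _].
    by move=> [-> _ _].
  by rewrite gt_max => /andP[].
exfalso; have [mfin|minf] := pselect (finite_set (below m)).
  by apply: ainf; apply: card_le_finite le _; exact: finite_setX.
by apply: (cardinal_card_lt acard ma); apply: card_le_trans le (IH m ma minf).
Qed.

(** A point is coded by an index whose set contains it together with its code in that set, so the
    union embeds into the square of [below a]. *)
Lemma card_le_bigcup {a} {I T : Type} (D : set I) (E : I -> set T) :
  infinite_set (below a) -> D #<= below a ->
  (forall i, D i -> E i #<= below a) -> \bigcup_(i in D) E i #<= below a.
Proof.
move=> ainf Da Ea; have [f fa finj] := card_le_fun a Da.
have /choice[g gP] : forall i, exists g : T -> O, D i ->
    (forall x, E i x -> below a (g x)) /\
    (forall x y, E i x -> E i y -> g x = g y -> x = y).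
  move=> i; have [/Ea/(card_le_fun a)[g ga ginj]|nDi] := pselect (D i).
    by exists g.
  by exists (fun=> a).
apply: card_le_trans (below_setX_le ainf).
apply: (card_le_rel (fun x p => exists i, [/\ D i, E i x & p = (f i, g i x)])).
  move=> x [i Di Eix]; exists (f i, g i x); last by exists i.
  by split => /=; [exact: fa|apply: (gP i Di).1].
move=> x y p _ _ [i [Di Eix ->]] [j [Dj Ejy [/(finj _ _ Di Dj) ij]]].
by subst j => /(gP i Di).2; apply.
Qed.

(** Lists are coded by iterating a pairing function. The code [enc] is only shown injective on lists
    of equal length, so the length is paired with it. *)
Lemma card_le_seq {a} : infinite_set (below a) ->
  [set s : seq O | forall x, x \in s -> x < a] #<= below a.
Proof.
move=> ainf; have [p pa pinj] := card_le_fun a (below_setX_le ainf).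
have [e ea einj] := card_le_fun a (iffLR (infiniteP _) ainf).
pose enc := foldr (fun x c => p (x, c)) (e 0%N).
have enca s : (forall x, x \in s -> x < a) -> below a (enc s).
  elim: s => [_|x s IH sa]; first exact: ea.
  apply: pa; split => /=; first by apply: sa; rewrite mem_head.
  by apply: IH => y ys; apply: sa; rewrite inE ys orbT.
have encinj s t : size s = size t -> (forall x, x \in s -> x < a) ->
    (forall x, x \in t -> x < a) -> enc s = enc t -> s = t.
  elim: s t => [|x s IH] [|y t] //= [st] sa ta.
  have sa' z : z \in s -> z < a by move=> zs; apply: sa; rewrite inE zs orbT.
  have ta' z : z \in t -> z < a by move=> zt; apply: ta; rewrite inE zt orbT.
  have xa : x < a by apply: sa; rewrite mem_head.
  have ya : y < a by apply: ta; rewrite mem_head.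
  have xs : (below a `*` below a) (x, enc s) by split => //; exact: enca.
  have yt : (below a `*` below a) (y, enc t) by split => //; exact: enca.
  by move=> /(pinj _ _ xs yt)[-> /(IH _ st sa' ta') ->].
apply: (card_le_rel (fun s c => c = p (e (size s), enc s))).
  move=> s sa; exists (p (e (size s), enc s)) => //.
  by apply: pa; split; [exact: ea|exact: enca].
move=> s t c sa ta ->.
have ss : (below a `*` below a) (e (size s), enc s).
  by split; [exact: ea|exact: enca].
have tt : (below a `*` below a) (e (size t), enc t).
  by split; [exact: ea|exact: enca].
move=> /(pinj _ _ ss tt)[/(einj _ _ Logic.I Logic.I) st].
exact: encinj.
Qed.

Lemma card_le_fset {a} : infinite_set (below a) ->
  [set s : {fset O} | [set` s] `<=` below a] #<= below a.
Proof.
move=> ainf; apply: card_le_trans (card_le_seq ainf).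
apply: (card_le_rel (fun (s : {fset O}) (l : seq O) => l = enum_fset s)).
  by move=> s sa; exists (enum_fset s) => // x xs; exact: sa.
by move=> s t l _ _ -> st; apply/fsetP => x; rewrite -[LHS]/(x \in enum_fset s) st.
Qed.

End OrdinalCardinality.

(** * Finite subsets and small sets of values *)

(** The analogue of [fin_subsets] over any choice type, so that finite sets of elements of [O] can
    be shared by all the filters. *)
Definition fsubsets {T : choiceType} (A : set T) : set {fset T} :=
  [set s | [set` s] `<=` A].

Lemma fsubsetsS {T : choiceType} (A B : set T) :
  A `<=` B -> fsubsets A `<=` fsubsets B.
Proof. by move=> AB s sA x /sA/AB. Qed.

Lemma fsubsets0 {T : choiceType} (A : set T) : fsubsets A fset0.
Proof. by move=> x; rewrite /= inE. Qed.

Lemma fset_val_image {T : choiceType} (A : set T) (x : set A) (s : {fset T}) :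
  fsubsets (val @` x) s ->
  exists2 s' : {fset A}, fsubsets x s' & s = [fset val y | y in s']%fset.
Proof.
move=> sx; pose B : set A := val @^-1` [set` s].
have Bfin : finite_set B.
  by apply: finite_preimage => [y z _ _ /val_inj|]; [|exact: finite_fset].
have sB y : (y \in fset_set B) = (val y \in s).
  by rewrite in_fset_set // /B; apply/idP/idP; rewrite inE.
exists (fset_set B).
  move=> y /=; rewrite sB => /sx[y' xy' /val_inj yy']; by rewrite -yy'.
apply/fsetP => z; apply/idP/imfsetP => /= [zs|[y + ->]]; last by rewrite sB.
by have [y xy yz] := sx _ zs; exists y; rewrite ?sB yz.
Qed.

(** Inverting an injection of [S] into [A] makes [S] the range of a map from [A], and that map
    determines [S]. This is how the values of small-valued maps get counted by [gam ^ theta]. *)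
Lemma card_le_small_sets {T V : Type} (A : set T) :
  [set S : set V | S !=set0 /\ S #<= A] #<= [set: A -> V].
Proof.
apply: (card_le_rel (fun S g => range g = S)); last by move=> S S' g _ _ -> ->.
move=> S [[s0 Ss0] SA].
have [t _] : A !=set0.
  by apply/set0P/eqP => A0; move: SA Ss0; rewrite A0 => /card_le0P ->.
have [f fA finj] := card_le_fun t SA.
have /choice[g gP] : forall c : A, exists v,
    S v /\ ((exists2 w, S w & f w = val c) -> f v = val c).
  move=> c; have [[w Sw wc]|nw] := pselect (exists2 w, S w & f w = val c).
    by exists w.
  by exists s0; split => // /nw.
exists g => //; apply/seteqP; split => [v [c _ <-]|v Sv]; first exact: (gP c).1.
exists (exist _ (f v) (mem_set (fA _ Sv))) => //.
set c := exist _ _ _; have [Sg fg] := gP c.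
by apply: finj => //; apply: fg; exists v.
Qed.

Lemma seq_max {d : Order.disp_t} {O : orderType d} (s : seq O) : s != [::] ->
  exists2 z, z \in s & forall y, y \in s -> y <= z.
Proof.
elim: s => // x s IH _; have [->|/IH[z zs zmax]] := eqVneq s [::].
  by exists x; rewrite ?mem_head // => y; rewrite inE => /eqP ->.
exists (Order.max x z).
  by rewrite maxEle; case: ifP; rewrite inE ?zs ?eqxx ?orbT.
by move=> y; rewrite inE le_max => /orP[/eqP ->|/zmax ->]; rewrite ?lexx ?orbT.
Qed.

(** * The combinatorial core: peeling blocks, with the filters abstracted as [Phi] *)

Section Blocks.
Context {d : Order.disp_t} {O : orderType d}.
Hypothesis O_wo : @well_ordered d O.
Variables (theta : O) (V I : Type) (f : {fset O} -> V) (lo hi : I -> O).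
Variable Phi : I -> set (set O).
Hypothesis theta_inf : infinite_set (below theta).

(** Nonemptiness is included because values are later counted as ranges of functions. *)
Definition small_valued (X : {fset O} -> set V) : Prop :=
  forall t, X t !=set0 /\ X t #<= below theta.

(** A single [A] serves every [t] below the block; completeness of the filters will provide this
    uniformity. *)
Hypothesis Phi_Rowbottom : forall i X, small_valued X ->
  exists2 A, Phi i A & forall t, fsubsets (below (lo i)) t ->
    [set X (t `|` u)%fset | u in fsubsets A] #<= below theta.
Hypothesis Phi_complete : forall i (A : seq I -> set O),
  (forall l, Phi i (A l)) -> Phi i (\bigcap_l A l).
Hypothesis blocks_sep : forall i j, [\/ i = j, hi i <= lo j | hi j <= lo i].
Hypothesis seqI_le : [set: seq I] #<= below theta.

Lemma homogeneous_blocks : exists A : I -> set O,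
  (forall i, Phi i (A i)) /\
  f @` fsubsets [set z | exists i, [/\ A i z, lo i <= z & z < hi i]]
    #<= below theta.
Proof.
(* [st] fixes a homogeneous set for each block and each small-valued map, with [setT] as default for
   other maps. *)
have /choice[st stP] : forall iX : I * ({fset O} -> set V), exists A,
    small_valued iX.2 -> Phi iX.1 A /\
      (forall t, fsubsets (below (lo iX.1)) t ->
       [set iX.2 (t `|` u)%fset | u in fsubsets A] #<= below theta).
  move=> [i X] /=; have [/(Phi_Rowbottom i)[A PA tA]|nX] := pselect (small_valued X).
    by exists A.
  by exists setT.
(* The second disjunct is a junk value keeping [next i X] small-valued. *)
pose next i X t : set V :=
  [set v | (fsubsets (below (lo i)) t /\
            exists2 u, fsubsets (st (i, X)) u & X (t `|` u)%fset v) \/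
           (~ fsubsets (below (lo i)) t /\ X t v)].
pose XX := foldr next (fun t => [set f t]).
have next_small i X : small_valued X -> small_valued (next i X).
  move=> Xs t; have [tlo|tlo] := pselect (fsubsets (below (lo i)) t); last first.
    have -> : next i X t = X t; last exact: Xs.
    by apply/seteqP; split => v /=; [case=> [[//]|[]]|right].
  have -> : next i X t =
      \bigcup_(S in [set X (t `|` u)%fset | u in fsubsets (st (i, X))]) S.
    apply/seteqP; split => v /=; first case=> [[_ [u su Xv]]|[//]].
      by exists (X (t `|` u)%fset) => //; exists u.
    by move=> [_ [u su <-] Xv]; left; split => //; exists u.
  split.
    have [v Xv] := (Xs t).1; exists v; exists (X (t `|` fset0)%fset).
      by exists fset0 => //; exact: fsubsets0.
    by rewrite fsetU0.
  apply: card_le_bigcup => //; first by apply: (stP (i, X) Xs).2.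
  by move=> _ [u _ <-]; apply: (Xs _).2.
have XX_small l : small_valued (XX l).
  elim: l => [|i l IH]; last exact: next_small.
  move=> t; split; first by exists (f t).
  apply: card_le_trans (iffLR (infiniteP _) theta_inf).
  exact: finite_set_countable (finite_set1 _).
exists (fun i => \bigcap_l st (i, XX l)); split.
  by move=> i; apply: Phi_complete => l; apply: (stP (i, XX l) (XX_small l)).1.
set x := [set z | _].
(* Induction on the size of [s]. The list [l] records the blocks already peeled off, the most
   recent, hence lowest, at its head. *)
have main n : forall s : {fset O}, (#|` s| <= n)%N -> fsubsets x s ->
    forall l v, XX l s v -> exists l', XX l' fset0 v.
  elim: n => [|n IH] s sn sx l v Xv.
    by exists l; move: sn; rewrite leqn0 cardfs_eq0 => /eqP <-.
  have [s0|sN0] := eqVneq s fset0; first by exists l; rewrite -s0.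
  have [|z zs zmax] := seq_max (enum_fset s).
    apply: contra_neq sN0 => s0; apply/fsetP => y.
    by rewrite -[LHS]/(y \in enum_fset s) s0 !inE.
  have [i [_ loz zhi]] := sx _ zs.
  (* The block [i] holds the maximum [z] of [s]. Since [z] lies in [u] and not in [t], the set [t]
     is strictly smaller than [s]. *)
  pose t := [fset y in s | y < lo i]%fset.
  pose u := [fset y in s | lo i <= y]%fset.
  have stu : s = (t `|` u)%fset.
    apply/fsetP => y; rewrite !inE /= -andb_orr.
    by case: (ltP y (lo i)); rewrite ?andbT.
  have ts : (t `<=` s)%fset by apply/fsubsetP => y; rewrite !inE => /andP[].
  apply: (IH t _ _ (i :: l) v).
  - rewrite -ltnS; apply: leq_trans sn; apply: fproper_ltn_card.
    rewrite fproperEneq ts andbT; apply/eqP => ts'.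
    by move: zs; rewrite -[_ \in _]/(z \in s) -ts' !inE ltNge loz andbF.
  - by move=> y /= /(fsubsetP ts)/sx.
  - left; split; first by move=> y /=; rewrite !inE => /andP[].
    exists u; last by rewrite -stu.
    move=> y /=; rewrite !inE => /andP[ys loy].
    have [j [Ajy jy yj]] := sx _ ys.
    (* The point [y] lies in both blocks [i] and [j], so [blocks_sep] forces them to coincide. *)
    suff -> : i = j by apply: Ajy.
    have yhi := le_lt_trans (zmax _ ys) zhi.
    case: (blocks_sep i j) => // h.
      by have := lt_le_trans yhi (le_trans h jy); rewrite ltxx.
    by have := lt_le_trans yj (le_trans h loy); rewrite ltxx.
apply: (@card_le_trans _ _ _ (\bigcup_(l in [set: seq I]) XX l fset0)).
  apply: subset_card_le => _ [s sx <-].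
  by have [|l Xl] := main _ s (leqnn _) sx [::] (f s) _; [|exists l].
apply: card_le_bigcup => // l _; exact: (XX_small l fset0).2.
Qed.

End Blocks.

(** * Rowbottom filters, read on sets of elements of [O] *)

Section RowbottomFilters.
Context {d : Order.disp_t} {O : orderType d}.
Hypothesis O_wo : @well_ordered d O.
Variables (theta theta_plus lam : O) (F : set_system (below lam)).
Hypothesis theta_plusE : is_succ_cardinal theta theta_plus.
Hypothesis F_Rowbottom : Rowbottom theta_plus F.

(** An injection of the range of [h] into [below del] turns [h] into a function with ordinal values,
    to which the Rowbottom property applies; its homogeneous set is then pushed into [O] by
    [val]. *)
Lemma Rowbottom_image {W : Type} (h : {fset O} -> W) (del : O) :
  range h #<= below del -> del < lam ->
  exists2 A : set O, F (val @^-1` A) & h @` fsubsets A #<= below theta.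
Proof.
move=> hdel dlam; have [g gdel ginj] := card_le_fun del hdel.
have hr s : range h (h s) by exists s.
have gh s : g (h s) \in below del by apply: mem_set; apply: gdel.
pose f' (s : {fset below lam}) : below del :=
  exist _ (g (h [fset val y | y in s]%fset)) (gh _).
have [_ _ _ /(_ del f' dlam)[x Fx /(card_ltE O_wo)[c ctheta fc]]] := F_Rowbottom.
exists (val @` x).
  have -> //: val @^-1` (val @` x) = x :> set (below lam).
  by apply/seteqP; split => [y [z xz /val_inj <-]//|y xy]; exists y.
apply: card_le_trans (succ_cardinal_le O_wo theta_plusE ctheta).
apply: card_le_trans fc.
apply: (card_le_rel (fun w v =>
  exists2 s', w = h [fset val y | y in s']%fset & v = f' s')).
  move=> _ [s /fset_val_image[s' s'x ->] <-]; exists (f' s'); last by exists s'.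
  by exists s'.
by move=> _ _ v _ _ [s -> ->] [s' -> /(congr1 val)/= /ginj]; apply.
Qed.

Hypothesis F_complete : filter_complete lam F.
Hypothesis lam_card : is_cardinal lam.

Lemma filter_complete_bigcap {J : Type} (D : set J) (A : J -> set O) (c : O) :
  D #<= below c -> c < lam -> (forall j, D j -> F (val @^-1` A j)) ->
  F (val @^-1` \bigcap_(j in D) A j).
Proof.
move=> Dc clam FA.
have -> : val @^-1` (\bigcap_(j in D) A j) =
    \bigcap_(B in [set val @^-1` A j | j in D]) B :> set (below lam).
  apply/seteqP; split => y /=.
    by move=> Ay _ [j Dj <-]; exact: Ay.
  by move=> Ay j Dj; apply: (Ay (val @^-1` A j)); exists j.
apply: F_complete; first by move=> _ [j Dj <-]; exact: FA.
by apply: card_lt_below lam_card clam _; apply: card_le_trans (card_image_le _ _) Dc.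
Qed.

(** As [lo] is infinite, it has at most [lo] many finite subsets [t]; completeness intersects the
    homogeneous sets of the maps sending [u] to the value of [X] at the union of [t] and [u]. *)
Lemma Rowbottom_uniform_image {W : Type} (X : {fset O} -> W) (lo del : O) :
  infinite_set (below lo) -> lo < lam ->
  range X #<= below del -> del < lam ->
  exists2 A : set O, F (val @^-1` A) &
    forall t, fsubsets (below lo) t ->
      [set X (t `|` u)%fset | u in fsubsets A] #<= below theta.
Proof.
move=> loinf lolam Xdel dlam.
have /choice[A AP] : forall t, exists A : set O, F (val @^-1` A) /\
    [set X (t `|` u)%fset | u in fsubsets A] #<= below theta.
  move=> t; have [||A FA hA] := @Rowbottom_image _ (fun u => X (t `|` u)%fset) del.
  - apply: card_le_trans Xdel; apply: subset_card_le.
    by move=> _ [u _ <-]; exists (t `|` u)%fset.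
  - exact: dlam.
  - by exists A.
exists (\bigcap_(t in fsubsets (below lo)) A t).
  apply: (@filter_complete_bigcap _ _ _ lo) => //.
    exact: card_le_fset.
  by move=> t _; exact: (AP t).1.
move=> t tlo; apply: card_le_trans (AP t).2; apply: subset_card_le.
move=> _ [u uA <-]; exists u => //; apply: fsubsetsS uA => y; exact.
Qed.

End RowbottomFilters.

(** * The filter on [kappa] *)

(** A cofinal map with finite domain would attain a largest value, but an infinite cardinal has no
    largest element. *)
Lemma cofinality_infinite {d : Order.disp_t} {O : orderType d} (k nu : O) :
  is_cardinal k -> infinite_set (below k) -> is_cofinality k nu ->
  infinite_set (below nu).
Proof.
move=> kcard kinf [[g gcof] _] nufin.
have [s sE] : exists s : seq O, range (val \o g) = [set` s].
  apply/finite_seqP/finite_image.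
  by apply: card_le_finite nufin; rewrite (card_le_eql (card_setT _)).
have sg x : val (g x) \in s.
  have : [set` s] (val (g x)) by rewrite -sE; exists x.
  by [].
have [y0 y0k] := infinite_setN0 kinf.
have [x0 _] := gcof (exist _ y0 (mem_set y0k)).
have [|z zs zmax] := seq_max s.
  by apply/eqP => s0; have := sg x0; rewrite s0.
have [x _ gx] : range (val \o g) z by rewrite sE.
have [|y zy yk] := @cardinal_no_max _ _ k z kcard kinf.
  by rewrite -gx; exact: (set_valP (g x)).
have [x' /= yx'] := gcof (exist _ y (mem_set yk)).
by have := lt_le_trans zy (le_trans yx' (zmax _ (sg x'))); rewrite ltxx.
Qed.

Theorem theorem2p1 (d : Order.disp_t) (O : orderType d)
    (O_wo : @well_ordered d O)
    (kappa nu theta theta_plus : O)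
    (kappa_card : is_cardinal kappa)
    (kappa_inf : infinite_set (below kappa))
    (nu_card : is_cardinal nu)
    (theta_card : is_cardinal theta)
    (theta_plusE : is_succ_cardinal theta theta_plus)
    (cf_kappa : is_cofinality kappa nu)
    (nu_le_theta : nu <= theta)
    (theta_lt_kappa : theta < kappa)
    (kap : O -> O)
    (kap_card : forall a : O, a < nu -> is_cardinal (kap a))
    (kap_incr : increasing_below nu kap)
    (kap_cont : continuous_below nu kap)
    (kap_sup : supremums (kap @` below nu) kappa)
    (F : forall a : O, set_system (below (kap a)))
    (F_complete : forall a b : O, a < nu -> is_succ a b ->
       filter_complete (kap b) (F b))
    (F_Rowbottom : forall a b : O, a < nu -> is_succ a b ->
       Rowbottom theta_plus (F b))
    (kappa_pow : forall gam : O, gam < kappa ->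
       card_lt [set: below theta -> below gam] (below kappa)) :
  exists G : set_system (below kappa), Rowbottom theta_plus G.
Proof.
have nu_inf := cofinality_infinite _ _ kappa_card kappa_inf cf_kappa.
have theta_inf : infinite_set (below theta).
  exact: sub_infinite_set (below_subset nu_le_theta) nu_inf.
(* [sc a] is the successor of [a], still below the infinite cardinal [nu]; outside [nu] its value is
   arbitrary. *)
have /choice[sc scP] : forall a, exists b, a < nu -> is_succ a b /\ b < nu.
  move=> a; have [anu|] := pselect (a < nu); last by exists a.
  have [y ay ynu] := cardinal_no_max nu_card nu_inf anu.
  have [|b ab bmin] := wf_least O_wo (fun b => a < b); first by exists y.
  by exists b => _; split => //; apply: le_lt_trans (bmin _ ay) ynu.
have succ_nu a anu := (scP a anu).2.
have kap_sc a : a < nu -> kap a < kap (sc a).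
  by move=> anu; have [[asc _] scnu] := scP a anu; exact: kap_incr.
have kap_lt a : a < nu -> kap a < kappa.
  move=> anu; apply: lt_le_trans (kap_sc a anu) _.
  by apply: kap_sup.1; exists (sc a) => //; exact: succ_nu.
have kap_mono a b : a <= b -> b < nu -> kap a <= kap b.
  by rewrite le_eqVlt => /orP[/eqP ->//|ab bnu]; apply/ltW/kap_incr.
have kap_cof x : x < kappa -> exists2 a, a < nu & x < kap a.
  move=> xk; apply: contrapT => na; have : kappa <= x.
    apply: kap_sup.2 => _ [a anu <-]; rewrite leNgt; apply/negP => xa.
    by apply: na; exists a.
  by rewrite leNgt xk.
have FR a : a < nu -> Rowbottom theta_plus (F (sc a)).
  by move=> anu; apply: (F_Rowbottom a) => //; apply: (scP a anu).1.
have FC a : a < nu -> filter_complete (kap (sc a)) (F (sc a)).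
  by move=> anu; apply: (F_complete a) => //; apply: (scP a anu).1.
have FF a : a < nu -> ProperFilter (F (sc a)) by move=> /FR[].
(* The trace passes through [O], since the two subtypes differ. *)
pose tr (x : set (below kappa)) a : set (below (kap (sc a))) :=
  val @^-1` (val @` x).
exists [set x | exists2 b, b < nu &
  forall a, b <= a -> a < nu -> F (sc a) (tr x a)].
split.
- apply: Build_ProperFilter_ex => [x [b bnu /(_ b (lexx _) bnu) Fx]|].
    have FFb := FF b bnu.
    have [y [z xz _]] := filter_ex Fx; by exists z.
  split.
  + have [b bnu] := infinite_setN0 nu_inf; exists b => // a _ anu.
    have FFa := FF a anu; apply: filterS filterT => y _.
    have yk : val y < kappa.
      by apply: lt_trans (set_valP y) _; apply: kap_lt; exact: succ_nu.
    by exists (exist _ (val y) (mem_set yk)).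
  + move=> x y [b bnu bx] [c cnu cy]; exists (Order.max b c).
      by rewrite gt_max bnu cnu.
    move=> a; rewrite ge_max => /andP[ba ca] anu; have FFa := FF a anu.
    apply: filterS (filterI (bx a ba anu) (cy a ca anu)).
    move=> w [[z xz zw] [z' yz' zw']]; exists z => //; split => //.
    by have -> : z = z' by apply: val_inj; rewrite zw zw'.
  + move=> x y xy [b bnu bx]; exists b => // a ba anu; have FFa := FF a anu.
    by apply: filterS (bx a ba anu) => w [z /xy yz zw]; exists z.
- move=> A [b bnu bA]; apply/card_eqPle; split.
    apply: (card_le_rel (fun y z => z = val y)).
      by move=> y _; exists (val y) => //; exact: (set_valP y).
    by move=> y y' z _ _ -> /val_inj.
  (* Otherwise [A] embeds into some [below p] with [p < kappa]. For large [a] its trace has full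
     size [kap (sc a) > p], by uniformity of [F (sc a)], yet embeds into [A]. *)
  have [[p pk Ap]|//] :=
    wf_card_le_or_set _ (below kappa) A O_wo order_trichotomy.
  have [c cnu pc] := kap_cof p pk.
  pose a := Order.max b c.
  have anu : a < nu by rewrite gt_max bnu cnu.
  have ba : b <= a by rewrite le_max lexx.
  have pa : p < kap (sc a).
    apply: lt_trans (kap_sc a anu); apply: lt_le_trans pc _.
    by apply: kap_mono => //; rewrite le_max lexx orbT.
  exfalso; apply: (cardinal_card_lt (kap_card _ (succ_nu a anu)) pa).
  have [_ /(_ _ (bA a ba anu))/card_eqPle[_ le_tr] _ _] := FR a anu.
  apply: (card_le_trans le_tr).
  apply: (@card_le_trans _ _ _ A).
    apply: (card_le_rel (fun y z => val z = val y)).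
      by move=> y [z Az zy]; exists z.
    by move=> y y' z _ _ -> /val_inj.
  by apply: (card_le_trans Ap); apply: subset_card_le => q [].
- move=> x xk; have [b bnu xb] := kap_cof x xk.
  exists b => // a ba anu.
  have xa : x < kap (sc a).
    by apply: lt_trans (kap_sc a anu); apply: lt_le_trans xb _; exact: kap_mono.
  have [FFa _ /(_ x xa) Fx _] := FR a anu; apply: filterS Fx => y xy.
  have yk : val y < kappa.
    by apply: lt_trans (set_valP y) _; apply: kap_lt; exact: succ_nu.
  by exists (exist _ (val y) (mem_set yk)).
move=> gam f gamk.
have [del delk powdel] := card_ltE O_wo (kappa_pow gam gamk).
(* Blocks start above [del], so that the Rowbottom property handles [gam ^ theta] values, and above
   [theta], so that completeness handles the intersection over all lists. *)
have [|b0 b0nu] := kap_cof (Order.max del theta); first by rewrite gt_max delk.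
rewrite gt_max => /andP[del_b0 theta_b0].
pose I := [set a | b0 <= a /\ a < nu].
have Inu (i : I) : val i < nu by case: (set_valP i).
have Ib0 (i : I) : b0 <= val i by case: (set_valP i).
pose lo (i : I) := kap (val i).
pose hi (i : I) := kap (sc (val i)).
have b0_lo x i : x < kap b0 -> x < lo i.
  by move=> xb0; apply: lt_le_trans xb0 _; exact: kap_mono.
have lo_hi i : lo i < hi i by exact: kap_sc.
have seqI_le : [set: seq I] #<= below theta.
  apply: card_le_trans (card_le_below nu_le_theta).
  apply: card_le_trans (card_le_seq O_wo nu_inf).
  apply: (card_le_rel (fun (s : seq I) l => l = map val s)).
    by move=> s _; exists (map val s) => // _ /mapP[i _ ->].
  by move=> s s' l _ _ -> /(inj_map val_inj).
pose Phi (i : I) (A : set O) := F (sc (val i)) (val @^-1` A).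
(* [f0] extends [f] to finite sets of elements of [O] by discarding the elements outside
   [below kappa]. *)
pose f0 (s : {fset O}) : below gam := f (fset_set (val @^-1` [set` s])).
have f0E (s : {fset below kappa}) : f0 [fset val y | y in s]%fset = f s.
  rewrite /f0; congr f; rewrite -[RHS]set_fsetK; congr fset_set.
  apply/seteqP; split => y /=; last by move=> ys; apply/imfsetP; exists y.
  by move=> /imfsetP[z /= zs /val_inj ->].
have [||||A [PhiA small]] :=
    @homogeneous_blocks _ _ O_wo theta _ _ f0 lo hi Phi theta_inf.
- move=> i X Xsmall.
  have [RF CF] := (FR _ (Inu i), FC _ (Inu i)).
  have hi_card := kap_card _ (succ_nu _ (Inu i)).
  apply: (Rowbottom_uniform_image O_wo _ _ _ _ theta_plusE RF CF hi_card X
    (lo i) del).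
  + by apply: sub_infinite_set theta_inf; apply/below_subset/ltW/b0_lo.
  + exact: lo_hi.
  + apply: card_le_trans powdel.
    apply: card_le_trans (card_le_small_sets (V := below gam) (below theta)).
    by apply: subset_card_le => _ [t _ <-]; exact: Xsmall.
  + exact: lt_trans (b0_lo _ _ del_b0) (lo_hi i).
- move=> i A PhiA.
  have hi_card := kap_card _ (succ_nu _ (Inu i)).
  apply: (filter_complete_bigcap _ _ (FC _ (Inu i)) hi_card _ _ theta) => //.
    exact: lt_trans (b0_lo _ _ theta_b0) (lo_hi i).
  by move=> l _; exact: PhiA.
- move=> i j; case: (ltgtP (val i) (val j)) => ij; last by apply: Or31; exact: val_inj.
  + apply: Or32; apply: kap_mono => //.
    by have [[_ scmin] _] := scP _ (Inu i); exact: scmin.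
  + apply: Or33; apply: kap_mono => //.
    by have [[_ scmin] _] := scP _ (Inu j); exact: scmin.
- exact: seqI_le.
(* For [a >= b0] the trace contains the intersection of [A i], where [i] is the index [a], with the
   end-segment from [lo i]; both belong to [F (sc a)]. *)
exists [set y : below kappa |
  exists i, [/\ A i (val y), lo i <= val y & val y < hi i]].
  exists b0 => // a b0a anu; have [FFa _ Fend _] := FR a anu.
  pose i : I := exist _ a (mem_set (conj b0a anu)).
  have FA : F (sc a) (val @^-1` A i) := PhiA i.
  apply: filterS (filterI FA (Fend _ (lo_hi i))) => y [Ay loy].
  have yk : val y < kappa.
    by apply: lt_trans (set_valP y) _; apply: kap_lt; exact: succ_nu.
  exists (exist _ (val y) (mem_set yk)) => //.
  by exists i; split => //; exact: (set_valP y).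
have [tp_card theta_tp _] := theta_plusE.
apply: card_lt_below tp_card theta_tp _; apply: card_le_trans small.
apply: subset_card_le => _ [s sx <-]; exists [fset val y | y in s]%fset => //.
by move=> _ /imfsetP[/= y /sx h ->].
Qed.
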